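(* For every information set $\Gamma\subseteq L$ and every $\alpha\in L$: $\Gamma\vdash_{\mathbf{WBD}}\alpha$ if and only if $\Gamma\vDash_{\mathbf{WBD}}\alpha$.
   Context: Let $\mathbf{PL}$ be classical propositional logic with language $L_{\mathbf{PL}}$ generated from a (possibly countably infinite) set of propositional atoms with the usual connectives, where $\bot$ and $\top$ are a canonical contradiction and a canonical tautology. $\vdash_{\mathbf{PL}}$ is classical deduction, $V$ is the set of classical valuations, and $M(\phi)\subseteq V$ is the set of models of $\phi\in L_{\mathbf{PL}}$. $\mathcal{P}X$ denotes the powerset of $X$. Language: $L=L_B\cup L_D$, where $L_B=L_{\mathbf{PL}}$ (potential beliefs) and $L_D=\{\overline{\phi}\mid\phi\in L_{\mathbf{PL}}\}$ (potential disbeliefs). Here $\overline{\phi}$ is a new formal expression, one for each $\phi\in L_{\mathbf{PL}}$; the bar is not a connective, so it is not nested or combined with connectives. An information set is any $\Gamma\subseteq L$; put $\Gamma_B=\Gamma\cap L_B$ and $\Gamma_D=\Gamma\cap L_D$. Deduction: $\vdash_{\mathbf{WBD}}$ is the smallest binary relation $\vdash$ from $\mathcal{P}L$ to $L$ closed under the following rules (for all $\Gamma\subseteq L$, $\phi,\psi\in L_B$): (B) if $\Gamma_B\vdash_{\mathbf{PL}}\phi$ then $\Gamma\vdash\phi$; (D$\bot$) if $\phi\vdash_{\mathbf{PL}}\bot$ then $\Gamma\vdash\overline{\phi}$; (WD) if $\overline{\psi}\in\Gamma_D$ and $\phi\vdash_{\mathbf{PL}}\psi$ then $\Gamma\vdash\overline{\phi}$.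 Semantics: a $\mathbf{WBD}$-model is an ordered pair $\mathcal{M}=(M,\mathcal{N})$ with $M\subseteq V$ and $\emptyset\subset\mathcal{N}\subseteq\mathcal{P}V$ (so $\mathcal{N}$ is a nonempty set of sets of valuations). For $\phi\in L_B$, $\mathcal{M}\Vdash\phi$ iff $M\subseteq M(\phi)$. For $\overline{\phi}\in L_D$, $\mathcal{M}\Vdash\overline{\phi}$ iff there is $N\in\mathcal{N}$ with $N\subseteq M(\lnot\phi)$. $\mathcal{M}\Vdash\Gamma$ iff $\mathcal{M}\Vdash\alpha$ for all $\alpha\in\Gamma$. $\Gamma\vDash_{\mathbf{WBD}}\alpha$ iff $\mathcal{M}\Vdash\alpha$ for every $\mathbf{WBD}$-model $\mathcal{M}$ with $\mathcal{M}\Vdash\Gamma$. *)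

(* Defs.v *)
From mathcomp Require Import all_boot.
From mathcomp Require Import classical_sets.

Set Implicit Arguments.
Unset Strict Implicit.
Unset Printing Implicit Defensive.

Local Open Scope classical_set_scope.

(* A [countType] of atoms is a finite or countably infinite set of atoms. *)
Inductive form (Atom : countType) : Type :=
  | Var of Atom
  | Bot
  | Top
  | Neg of form Atom
  | And of form Atom & form Atom
  | Or of form Atom & form Atom
  | Imp of form Atom & form Atom
  | Iff of form Atom & form Atom.

Arguments Var {Atom}.
Arguments Bot {Atom}.
Arguments Top {Atom}.

(* Classical deduction from an arbitrary, possibly infinite, set of premises:
   natural deduction, where [PL_RAA] is the classical reductio rule. *)
Inductive PL_entails (Atom : countType) :
    set (form Atom) -> form Atom -> Prop :=
  | PL_hyp (G : set (form Atom)) p : G p -> PL_entails G p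
  | PL_TopI G : PL_entails G Top
  | PL_BotE G p : PL_entails G Bot -> PL_entails G p
  | PL_NegI G p : PL_entails (p |` G) Bot -> PL_entails G (Neg p)
  | PL_NegE G p : PL_entails G (Neg p) -> PL_entails G p -> PL_entails G Bot
  | PL_RAA G p : PL_entails (Neg p |` G) Bot -> PL_entails G p
  | PL_AndI G p q : PL_entails G p -> PL_entails G q -> PL_entails G (And p q)
  | PL_AndE1 G p q : PL_entails G (And p q) -> PL_entails G p
  | PL_AndE2 G p q : PL_entails G (And p q) -> PL_entails G q
  | PL_OrI1 G p q : PL_entails G p -> PL_entails G (Or p q)
  | PL_OrI2 G p q : PL_entails G q -> PL_entails G (Or p q)
  | PL_OrE G p q r :
      PL_entails G (Or p q) -> PL_entails (p |` G) r ->
      PL_entails (q |` G) r -> PL_entails G r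
  | PL_ImpI G p q : PL_entails (p |` G) q -> PL_entails G (Imp p q)
  | PL_ImpE G p q : PL_entails G (Imp p q) -> PL_entails G p -> PL_entails G q
  | PL_IffI G p q :
      PL_entails (p |` G) q -> PL_entails (q |` G) p -> PL_entails G (Iff p q)
  | PL_IffE1 G p q : PL_entails G (Iff p q) -> PL_entails G p -> PL_entails G q
  | PL_IffE2 G p q : PL_entails G (Iff p q) -> PL_entails G q -> PL_entails G p.

Definition valuation (Atom : countType) : Type := Atom -> bool.

Fixpoint eval (Atom : countType) (v : valuation Atom) (p : form Atom) : bool :=
  match p with
  | Var a => v a
  | Bot => false
  | Top => true
  | Neg q => ~~ eval v q
  | And q r => eval v q && eval v r
  | Or q r => eval v q || eval v r
  | Imp q r => eval v q ==> eval v r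
  | Iff q r => eval v q == eval v r
  end.

Definition models (Atom : countType) (p : form Atom) : set (valuation Atom) :=
  [set v | eval v p].

(* The language [L], the disjoint union of [L_B] and [L_D]: [Bel p] is [p] as a
   potential belief and [Dis p] is the formal expression "p overlined". *)
Inductive info (Atom : countType) : Type :=
  | Bel of form Atom
  | Dis of form Atom.

(* [Gamma_B] and [Gamma_D], each given by the underlying set of formulas. *)
Definition beliefs (Atom : countType) (Gamma : set (info Atom)) :
    set (form Atom) := [set p | Gamma (Bel p)].

Definition disbeliefs (Atom : countType) (Gamma : set (info Atom)) :
    set (form Atom) := [set p | Gamma (Dis p)].

Inductive WBD_entails (Atom : countType) (Gamma : set (info Atom)) :
    info Atom -> Prop :=
  | WBD_B p : PL_entails (beliefs Gamma) p -> WBD_entails Gamma (Bel p)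
  | WBD_Dbot p : PL_entails [set p] Bot -> WBD_entails Gamma (Dis p)
  | WBD_WD p q :
      disbeliefs Gamma q -> PL_entails [set p] q -> WBD_entails Gamma (Dis p).

Record WBD_model (Atom : countType) : Type := {
  bel_vals : set (valuation Atom);
  dis_vals : set (set (valuation Atom));
  dis_vals_nonempty : dis_vals !=set0 }.

Definition sat (Atom : countType) (M : WBD_model Atom) (a : info Atom) : Prop :=
  match a with
  | Bel p => bel_vals M `<=` models p
  | Dis p => exists2 N, dis_vals M N & N `<=` models (Neg p)
  end.

Definition sat_set (Atom : countType) (M : WBD_model Atom)
    (Gamma : set (info Atom)) : Prop :=
  forall a, Gamma a -> sat M a.

Definition WBD_conseq (Atom : countType) (Gamma : set (info Atom))
    (a : info Atom) : Prop :=
  forall M : WBD_model Atom, sat_set M Gamma -> sat M a.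

(* Main.v *)
Require Import Defs.
From mathcomp Require Import all_boot.
From mathcomp Require Import boolp classical_sets.

(** The rules (B), (D$\bot$) and (WD) mirror the truth clauses, so everything
    reduces to strong completeness of classical propositional logic.  A belief
    is tested on the model whose belief component consists of all valuations of
    [beliefs Gamma] and whose only disbelief component is empty, which satisfies
    every disbelief.  A disbelief is tested on the model with empty belief
    component whose disbelief components are the full set of valuations and the
    sets [models (Neg q)] for [Dis q] in [Gamma]: the full set accounts for
    (D$\bot$), and [models (Neg q)] for (WD) by contraposition. *)

Set Implicit Arguments.
Unset Strict Implicit.
Unset Printing Implicit Defensive.

Local Open Scope classical_set_scope.

Section PropositionalLogic.
Variable Atom : countType.
Implicit Types (G H S : set (form Atom)) (p q r : form Atom).
Implicit Type v : valuation Atom.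

Lemma PL_weaken G H p : G `<=` H -> PL_entails G p -> PL_entails H p.
Proof.
(* [H] stays general in the induction because rules that discharge a hypothesis enlarge both premise
   sets. *)
move=> GH Gp; elim: Gp H GH => {G p}.
- by move=> G p Gp H GH; apply/PL_hyp/GH.
- by move=> G H _; apply: PL_TopI.
- by move=> G p _ IH H GH; apply/PL_BotE/IH.
- by move=> G p _ IH H GH; apply/PL_NegI/IH/setUS.
- by move=> G p _ IH1 _ IH2 H GH; apply: (@PL_NegE _ _ p); [apply: IH1|apply: IH2].
- by move=> G p _ IH H GH; apply/PL_RAA/IH/setUS.
- by move=> G p q _ IH1 _ IH2 H GH; apply: PL_AndI; [apply: IH1|apply: IH2].
- by move=> G p q _ IH H GH; apply/PL_AndE1/IH.
- by move=> G p q _ IH H GH; apply/PL_AndE2/IH.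
- by move=> G p q _ IH H GH; apply/PL_OrI1/IH.
- by move=> G p q _ IH H GH; apply/PL_OrI2/IH.
- move=> G p q r _ IH1 _ IH2 _ IH3 H GH; apply: (@PL_OrE _ _ p q).
  + exact: IH1.
  + exact/IH2/setUS.
  + exact/IH3/setUS.
- by move=> G p q _ IH H GH; apply/PL_ImpI/IH/setUS.
- by move=> G p q _ IH1 _ IH2 H GH; apply: (@PL_ImpE _ _ p); [apply: IH1|apply: IH2].
- by move=> G p q _ IH1 _ IH2 H GH; apply: PL_IffI; [apply/IH1/setUS|apply/IH2/setUS].
- by move=> G p q _ IH1 _ IH2 H GH; apply: (@PL_IffE1 _ _ p); [apply: IH1|apply: IH2].
- by move=> G p q _ IH1 _ IH2 H GH; apply: (@PL_IffE2 _ _ p q); [apply: IH1|apply: IH2].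
Qed.

Lemma PL_weakenU G p q : PL_entails G p -> PL_entails (q |` G) p.
Proof. by apply: PL_weaken => r; right. Qed.

Lemma PL_hyp1 G p : PL_entails (p |` G) p.
Proof. by apply: PL_hyp; left. Qed.

Lemma PL_sound G p v :
  PL_entails G p -> (forall q, G q -> eval v q) -> eval v p.
Proof.
have ext H q : (forall r, H r -> eval v r) -> eval v q ->
    forall r, (q |` H) r -> eval v r by move=> Hv qv r [->|/Hv].
elim=> {G p} /=.
- by move=> G p Gp; apply.
- by [].
- by move=> G p _ IH /IH.
- by move=> G p _ IH Gv; apply/negP => pv; have := IH (ext _ _ Gv pv).
- by move=> G p _ IH1 _ IH2 Gv; move: (IH1 Gv); rewrite (IH2 Gv).
- move=> G p _ IH Gv; apply/negPn/negP => pv.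
  by have := IH (ext _ (Neg p) Gv pv).
- by move=> G p q _ IH1 _ IH2 Gv; rewrite IH1 ?IH2.
- by move=> G p q _ IH /IH/andP[].
- by move=> G p q _ IH /IH/andP[].
- by move=> G p q _ IH /IH ->.
- by move=> G p q _ IH /IH ->; rewrite orbT.
- move=> G p q r _ IH1 _ IH2 _ IH3 Gv.
  by case/orP: (IH1 Gv) => [/(ext _ _ Gv)/IH2|/(ext _ _ Gv)/IH3].
- by move=> G p q _ IH Gv; apply/implyP => /(ext _ _ Gv)/IH.
- by move=> G p q _ IH1 _ IH2 Gv; apply: (implyP (IH1 Gv)); apply: IH2.
- move=> G p q _ IH1 _ IH2 Gv.
  by apply/eqP; apply/idP/idP => [/(ext _ _ Gv)/IH1|/(ext _ _ Gv)/IH2].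
- by move=> G p q _ IH1 _ IH2 Gv; rewrite -(eqP (IH1 Gv)); apply: IH2.
- by move=> G p q _ IH1 _ IH2 Gv; rewrite (eqP (IH1 Gv)); apply: IH2.
Qed.

(* Indexing the family lets the induction pass from [f] to [p |` f i] in the
   rules that discharge a hypothesis, without any finite sets of premises. *)
Lemma PL_compact (I : Type) (D : set I) (f : I -> set (form Atom)) G p :
    D !=set0 ->
    (forall i j, D i -> D j ->
       exists2 k, D k & f i `<=` f k /\ f j `<=` f k) ->
  G `<=` \bigcup_(i in D) f i -> PL_entails G p ->
  exists2 i, D i & PL_entails (f i) p.
Proof.
move=> D0; pose fam := I -> set (form Atom).
pose dir (f : fam) := forall i j, D i -> D j ->
  exists2 k, D k & f i `<=` f k /\ f j `<=` f k.
pose goal (f : fam) p := exists2 i, D i & PL_entails (f i) p.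
have map1 f' q r : (forall H, PL_entails H q -> PL_entails H r) ->
    goal f' q -> goal f' r.
  by move=> qr [i Di /qr fr]; exists i.
have dirU f' q : dir f' -> dir (fun i => q |` f' i).
  move=> fdir i j Di Dj; have [k Dk [ik jk]] := fdir i j Di Dj.
  by exists k => //; split; apply: setUS.
have subU H (f' : fam) q : H `<=` \bigcup_(i in D) f' i ->
    q |` H `<=` \bigcup_(i in D) (q |` f' i).
  move=> Hf r [->|/Hf[i Di fr]]; last by exists i => //; right.
  by case: D0 => i Di; exists i => //; left.
(* Two premises derived at different indices are moved to a common one by directedness. Letting [g]
   and [h] differ from [f'] covers rules whose premises carry extra hypotheses. *)
have join (f' g h : fam) q r : dir f' ->
    (forall i j, f' i `<=` f' j -> g i `<=` g j) ->
    (forall i j, f' i `<=` f' j -> h i `<=` h j) -> goal g q -> goal h r ->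
    exists2 i, D i & PL_entails (g i) q /\ PL_entails (h i) r.
  move=> fdir gm hm [i Di gq] [j Dj hr].
  have [k Dk [ik jk]] := fdir i j Di Dj; exists k => //; split.
    exact: PL_weaken (gm _ _ ik) gq.
  exact: PL_weaken (hm _ _ jk) hr.
have monU (f' : fam) q i j : f' i `<=` f' j -> q |` f' i `<=` q |` f' j.
  exact: setUS.
move=> + + Gp; elim: Gp f => {G p}.
- by move=> G p Gp f fdir /(_ _ Gp)[i Di fp]; exists i => //; apply: PL_hyp.
- by move=> G f _ _; case: D0 => i Di; exists i => //; apply: PL_TopI.
- by move=> G p _ IH f fd Gf; apply: map1 (IH f fd Gf) => H; apply: PL_BotE.
- move=> G p _ IH f fd Gf.
  by have [i Di ?] := IH _ (dirU f p fd) (subU _ _ _ Gf); exists i => //; apply: PL_NegI.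
- move=> G p _ IH1 _ IH2 f fd Gf.
  have [//|//|i Di [? ?]] := join f f f _ _ fd _ _ (IH1 _ fd Gf) (IH2 _ fd Gf).
  by exists i => //; apply: (@PL_NegE _ _ p).
- move=> G p _ IH f fd Gf.
  by have [i Di ?] := IH _ (dirU f _ fd) (subU _ _ _ Gf); exists i => //; apply: PL_RAA.
- move=> G p q _ IH1 _ IH2 f fd Gf.
  have [//|//|i Di [? ?]] := join f f f _ _ fd _ _ (IH1 _ fd Gf) (IH2 _ fd Gf).
  by exists i => //; apply: PL_AndI.
- by move=> G p q _ IH f fd Gf; apply: map1 (IH f fd Gf) => H; apply: PL_AndE1.
- by move=> G p q _ IH f fd Gf; apply: map1 (IH f fd Gf) => H; apply: PL_AndE2.
- by move=> G p q _ IH f fd Gf; apply: map1 (IH f fd Gf) => H; apply: PL_OrI1.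
- by move=> G p q _ IH f fd Gf; apply: map1 (IH f fd Gf) => H; apply: PL_OrI2.
- move=> G p q r _ IH1 _ IH2 _ IH3 f fd Gf.
  (* [join] merges the two case branches; a further upper bound then brings in the disjunction. *)
  have [i Di fpq] := IH1 _ fd Gf.
  have [||j Dj [fp fq]] := join f _ _ _ _ fd _ _
    (IH2 _ (dirU f p fd) (subU _ _ _ Gf)) (IH3 _ (dirU f q fd) (subU _ _ _ Gf)).
  + by move=> ? ?; apply: monU.
  + by move=> ? ?; apply: monU.
  have [k Dk [ik jk]] := fd i j Di Dj; exists k => //.
  apply: (@PL_OrE _ _ p q); first exact: PL_weaken fpq.
    by apply: PL_weaken fp; apply: setUS.
  by apply: PL_weaken fq; apply: setUS.
- move=> G p q _ IH f fd Gf.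
  by have [i Di ?] := IH _ (dirU f _ fd) (subU _ _ _ Gf); exists i => //; apply: PL_ImpI.
- move=> G p q _ IH1 _ IH2 f fd Gf.
  have [//|//|i Di [? ?]] := join f f f _ _ fd _ _ (IH1 _ fd Gf) (IH2 _ fd Gf).
  by exists i => //; apply: (@PL_ImpE _ _ p).
- move=> G p q _ IH1 _ IH2 f fd Gf.
  have [||j Dj [fp fq]] := join f _ _ _ _ fd _ _
    (IH1 _ (dirU f p fd) (subU _ _ _ Gf)) (IH2 _ (dirU f q fd) (subU _ _ _ Gf)).
  + by move=> ? ?; apply: monU.
  + by move=> ? ?; apply: monU.
  by exists j => //; apply: PL_IffI.
- move=> G p q _ IH1 _ IH2 f fd Gf.
  have [//|//|i Di [? ?]] := join f f f _ _ fd _ _ (IH1 _ fd Gf) (IH2 _ fd Gf).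
  by exists i => //; apply: (@PL_IffE1 _ _ p).
- move=> G p q _ IH1 _ IH2 f fd Gf.
  have [//|//|i Di [? ?]] := join f f f _ _ fd _ _ (IH1 _ fd Gf) (IH2 _ fd Gf).
  by exists i => //; apply: (@PL_IffE2 _ _ p q).
Qed.

(** Zorn's lemma yields a maximal set consistent with [G]; compactness handles unions of chains.
    Consistency is tested after adjoining [G], so chain members need not contain [G] and the empty
    chain is covered by the consistency of [G] itself. *)
Lemma PL_lindenbaum G : ~ PL_entails G Bot ->
  exists T, [/\ G `<=` T, ~ PL_entails T Bot &
    forall p, PL_entails T p \/ PL_entails T (Neg p)].
Proof.
move=> Gcons; pose P S := ~ PL_entails (S `|` G) Bot.
have [|A [PA Amax]] := @Zorn_bigcup _ P.
  move=> F FP Ftot Fbot.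
  (* Adding [set0] makes the chain nonempty. *)
  have [||q|S] := @PL_compact _ (set0 |` F) (fun S => S `|` G) _ _ _ _ _ Fbot.
  - by exists set0; left.
  - move=> S1 S2 [->|F1] D2; first by exists S2 => //; split=> //; apply: setSU.
    case: D2 => [->|F2]; first by exists S1; [right|split=> //; apply: setSU].
    case: (Ftot _ _ F1 F2) => S12.
      by exists S2; [right|split=> //; apply: setSU].
    by exists S1; [right|split=> //; apply: setSU].
  - case=> [[S FS Sp]|Gp]; first by exists S; [right|left].
    by exists set0; [left|right].
  - by case=> [->|/FP //]; rewrite set0U.
exists (A `|` G); split=> // p.
have [?|np] := pselect (PL_entails (A `|` G) p); [by left|right].
have [Ap|nAp] := pselect (A (Neg p)); first by apply: PL_hyp; left.
(* By reductio, adjoining [Neg p] is consistent when [p] is not derivable, so a maximal [A] already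
   contains [Neg p]. *)
exfalso; apply: (Amax (Neg p |` A)).
  by split=> [q Aq|/(_ _ (or_introl erefl)) //]; right.
by rewrite /P -setUA => /PL_RAA.
Qed.

(** Kalmár's lemma: once [G] decides every atom as [v] does, structural induction propagates this
    through the connectives. *)
Lemma PL_truth G v p :
    (forall a, PL_entails G (if v a then Var a else Neg (Var a))) ->
  PL_entails G (if eval v p then p else Neg p).
Proof.
move=> Gv.
have neg_hyp H q r : PL_entails H (Neg q) -> PL_entails (q |` H) r.
  move=> Hq; apply/PL_BotE/(@PL_NegE _ _ q)/PL_hyp1.
  exact: PL_weakenU.
elim: p => [a|||p IHp|p IHp q IHq|p IHp q IHq|p IHp q IHq|p IHp q IHq] /=.
- exact: Gv.
- exact/PL_NegI/PL_hyp1.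
- exact: PL_TopI.
- case: (eval v p) IHp => //= Gp.
  by apply/PL_NegI/(@PL_NegE _ _ p)/PL_weakenU/Gp/PL_hyp1.
- case: (eval v p) IHp => /= Gp; last first.
    apply/PL_NegI/(@PL_NegE _ _ p); first exact: PL_weakenU.
    exact/PL_AndE1/PL_hyp1.
  case: (eval v q) IHq => Gq; first exact: PL_AndI.
  apply/PL_NegI/(@PL_NegE _ _ q); first exact: PL_weakenU.
  exact/PL_AndE2/PL_hyp1.
- case: (eval v p) IHp => /= Gp; first exact: PL_OrI1.
  case: (eval v q) IHq => Gq; first exact: PL_OrI2.
  apply/PL_NegI/(@PL_OrE _ _ p q); first exact: PL_hyp1.
    exact/neg_hyp/PL_weakenU.
  exact/neg_hyp/PL_weakenU.
- case: (eval v p) IHp => /= Gp; last exact/PL_ImpI/neg_hyp.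
  case: (eval v q) IHq => Gq; first exact/PL_ImpI/PL_weakenU.
  apply/PL_NegI/(@PL_NegE _ _ q); first exact: PL_weakenU.
  by apply: (@PL_ImpE _ _ p); [apply: PL_hyp1|apply: PL_weakenU].
- case: (eval v p) IHp => /= Gp; case: (eval v q) IHq => Gq /=.
  + by apply: PL_IffI; apply: PL_weakenU.
  + apply/PL_NegI/(@PL_NegE _ _ q); first exact: PL_weakenU.
    by apply: (@PL_IffE1 _ _ p); [apply: PL_hyp1|apply: PL_weakenU].
  + apply/PL_NegI/(@PL_NegE _ _ p); first exact: PL_weakenU.
    by apply: (@PL_IffE2 _ _ p q); [apply: PL_hyp1|apply: PL_weakenU].
  + by apply: PL_IffI; apply: neg_hyp.
Qed.

(** The valuation makes true exactly the atoms derivable from a consistent, deciding extension [T].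
    A member of [T] evaluated to false would have its negation derivable as well. *)
Lemma PL_consistent_model G : ~ PL_entails G Bot ->
  exists v, forall p, G p -> eval v p.
Proof.
case/PL_lindenbaum=> T [GT Tcons Tdec].
pose v a := `[< PL_entails T (Var a) >].
exists v => p /GT Tp.
have : PL_entails T (if eval v p then p else Neg p).
  apply: PL_truth => a; rewrite /v; case: asboolP => // nTa.
  by case: (Tdec (Var a)).
case: (eval v p) => // Tnp.
by case: Tcons; apply: (PL_NegE Tnp); apply: PL_hyp.
Qed.

Lemma PL_complete G p :
  (forall v, (forall q, G q -> eval v q) -> eval v p) -> PL_entails G p.
Proof.
move=> Gp; apply: contrapT => nGp.
(* If [p] is not derivable, [Neg p] is consistent with [G], and a model of both is a
   countermodel. *)
have [/PL_RAA //|v vm] := @PL_consistent_model (Neg p |` G).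
have /negP := vm (Neg p) (or_introl erefl); apply.
by apply: Gp => q Gq; apply: vm; right.
Qed.

End PropositionalLogic.

Lemma WBD_sound (Atom : countType) (Gamma : set (info Atom)) (a : info Atom) :
  WBD_entails Gamma a -> WBD_conseq Gamma a.
Proof.
case=> [p Gp M MG v Mv|p pbot M MG|p q Gq pq M MG] /=.
- by apply: (PL_sound Gp) => q /MG /(_ _ Mv).
(* Any [N] serves, since a contradictory [p] is false everywhere. *)
- have [N MN] := dis_vals_nonempty M; exists N => // v _.
  apply/negP => pv; suff: eval v Bot by [].
  by apply: (PL_sound pbot) => _ ->.
- have [N MN Nq] := MG _ Gq; exists N => // v /Nq /negP qv.
  by apply/negP => pv; apply/qv/(PL_sound pq) => _ ->.
Qed.

Lemma WBD_complete (Atom : countType) (Gamma : set (info Atom))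
    (a : info Atom) :
  WBD_conseq Gamma a -> WBD_entails Gamma a.
Proof.
case: a => p Gp.
  have N0 : [set set0 : set (valuation Atom)] !=set0 by exists set0.
  pose M := {| bel_vals := [set v | forall q, beliefs Gamma q -> eval v q];
               dis_vals_nonempty := N0 |}.
  apply/WBD_B/PL_complete; apply: (Gp M).
  by case=> q Gq /=; [move=> v; apply|exists set0].
have N0 : (setT |` [set models (Neg q) | q in disbeliefs Gamma]) !=set0.
  by exists setT; left.
pose M := {| bel_vals := set0; dis_vals_nonempty := N0 |}.
(* The witness for [Dis p] tells which rule to use: the full set makes [p] unsatisfiable, while
   [models (Neg q)] makes [p] entail [q]. *)
have [|_ [->|[q Gq <-]] Np] := Gp M.
- case=> q Gq //=; exists (models (Neg q)) => //; by right; exists q.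
- apply/WBD_Dbot/PL_complete => v /(_ _ erefl) pv.
  by move: (Np v I); rewrite /models /= pv.
- apply: (WBD_WD Gq); apply: PL_complete => v /(_ _ erefl) pv.
  by apply/negPn/negP => /Np; rewrite /models /= pv.
Qed.

Theorem theorem1 (Atom : countType) (Gamma : set (info Atom))
    (alpha : info Atom) :
  WBD_entails Gamma alpha <-> WBD_conseq Gamma alpha.
Proof. by split; [apply: WBD_sound|apply: WBD_complete]. Qed.
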